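(* Let $J=\mathbb{N}$ and $J^*=\mathbb{N}\setminus\{1\}$, or $J=J^*=\mathbb{Z}$. Let $(X_k)_{k\in J}$ be Banach spaces, let $T_k\in L(X_k,X_{k-1})$ for $k\in J^*$ with $\sup_{k\in J^*}\|T_k\|<\infty$, and consider $B_{(T_k)}$ on $\ell^p((X_k)_k,J)$ with $1\le p<\infty$ or on $c_0((X_k)_k,J)$. If $B_{(T_k)}$ is chaotic, then $B_{(T_k)}$ is frequently hypercyclic.
   Context: $\mathbb{N}=\{1,2,3,\dots\}$; $L(X,Z)$ denotes the bounded linear operators from $X$ to $Z$. $\ell^p((X_k)_k,J)=\{(x_k)_{k}\in\prod_{k\in J} X_k:\sum_k\|x_k\|^p<\infty\}$ with the $\ell^p$-norm, and $c_0((X_k)_k,J)=\{(x_k)_k\in\prod_{k\in J} X_k:\lim_{|k|\to\infty}\|x_k\|=0\}$ with the sup norm. The shift is $B_{(T_k)}(x_k)_{k\in J}=(T_{k+1}x_{k+1})_{k\in J}$; it is a bounded operator because $\sup_k\|T_k\|<\infty$. An operator $S$ on a Banach space $Y$ is chaotic if it is hypercyclic (some $y\in Y$ has dense orbit $\{S^ny:n\ge 0\}$) and its set of periodic points (those $y$ with $S^dy=y$ for some $d\ge1$) is dense in $Y$; it is frequently hypercyclic if there exists $y\in Y$ such that for every non-empty open set $U\subset Y$ the set $\{n\ge 0:S^ny\in U\}$ has positive lower density. The lower density of $A\subset\mathbb{N}\cup\{0\}$ is $\liminf_{N\to\infty}\frac{|A\cap[0,N]|}{N+1}$. *)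

(* Defs.v *)
From HB Require Import structures.
From mathcomp Require Import all_boot all_order all_algebra.
From mathcomp Require Import all_classical all_reals all_analysis.
From mathcomp Require Import complex.
From mathcomp Require Import ring lra zify.
Import Order.TTheory GRing.Theory Num.Theory.
Import numFieldNormedType.Exports.

Set Implicit Arguments.
Unset Strict Implicit.
Unset Printing Implicit Defensive.

Local Open Scope classical_set_scope.
Local Open Scope ring_scope.

(* The Banach spaces are over R or over C. In MathComp-Analysis the norm of a
   normed module takes its values in the scalar field; [to_real] and [of_real]
   move between the nonnegative elements of that field and R. *)
Variant scalars := RealScalars | ComplexScalars.

Definition scalar_field (R : realType) (s : scalars) : numFieldType :=
  match s with
  | RealScalars => R
  | ComplexScalars => R[i]
  end.

Section scalar_field.
Context {R : realType} {s : scalars}.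
Local Notation K := (scalar_field R s).

Definition to_real : K -> R :=
  match s return scalar_field R s -> R with
  | RealScalars => id
  | ComplexScalars => @complex.Re R
  end.

Definition of_real : R -> K :=
  match s return R -> scalar_field R s with
  | RealScalars => id
  | ComplexScalars => real_complex R
  end.

Lemma of_realK : cancel of_real to_real.
Proof. by rewrite /of_real /to_real; case: s. Qed.

Lemma to_realK (x : K) : 0 <= x -> of_real (to_real x) = x.
Proof.
move: x; rewrite /of_real /to_real; case: s => //= -[a b].
by rewrite lecE /= => /andP[/eqP -> _].
Qed.

Lemma of_realD : {morph of_real : x y / x + y}.
Proof.
rewrite /of_real; case: s => //= x y.
exact: (raddfD (real_complex R)).
Qed.

Lemma of_realM : {morph of_real : x y / x * y}.
Proof.
rewrite /of_real; case: s => //= x y.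
exact: (rmorphM (real_complex R)).
Qed.

Lemma of_real0 : of_real 0 = 0. Proof. by rewrite /of_real; case: s. Qed.

Lemma of_real1 : of_real 1 = 1. Proof. by rewrite /of_real; case: s. Qed.

Lemma ler_of_real : {mono of_real : x y / x <= y}.
Proof.
by rewrite /of_real; case: s => //= x y; rewrite lecR.
Qed.

End scalar_field.

Section real_norm.
Context {R : realType} {s : scalars} {V : normedModType (scalar_field R s)}.
Implicit Types x y : V.

Definition rnorm x : R := to_real `|x|.

Lemma of_real_rnorm x : of_real (rnorm x) = `|x|.
Proof. exact: to_realK. Qed.

Lemma rnorm_ge0 x : 0 <= rnorm x.
Proof. by rewrite -(@ler_of_real _ s) of_real_rnorm of_real0. Qed.

Lemma rnorm0 : rnorm (0 : V) = 0.
Proof. by rewrite /rnorm normr0 -(@of_real0 _ s) of_realK. Qed.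

Lemma rnorm_eq0 x : rnorm x = 0 -> x = 0.
Proof.
by move=> x0; apply/normr0_eq0; rewrite -of_real_rnorm x0 of_real0.
Qed.

Lemma ler_rnormD x y : rnorm (x + y) <= rnorm x + rnorm y.
Proof.
by rewrite -(@ler_of_real _ s) of_realD !of_real_rnorm ler_normD.
Qed.

Lemma rnormZ (l : scalar_field R s) x :
  rnorm (l *: x) = to_real `|l| * rnorm x.
Proof.
apply: (can_inj (@of_realK _ s)).
by rewrite of_realM !of_real_rnorm to_realK// normrZ.
Qed.

End real_norm.

Section operator_norm.
Context {R : realType} {s : scalars}.
Variables V W : normedModType (scalar_field R s).

Definition opnorm (f : V -> W) : R :=
  sup [set rnorm (f x) | x in [set x | rnorm x <= 1]].

Lemma opnormP (f : {linear V -> W}) (x : V) : continuous f ->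
  rnorm (f x) <= opnorm f * rnorm x.
Proof.
move=> cf.
have /linear_boundedP/pinfty_ex_gt0[r r0 fr] : bounded_near f (nbhs (0 : V)).
  exact/continuous_linear_bounded/cf.
have ub : has_ubound [set rnorm (f x) | x in [set x | rnorm x <= 1]].
  exists (to_real r) => _ [z /= z1 <-].
  rewrite -(@ler_of_real _ s) of_real_rnorm to_realK; last exact: ltW.
  apply: (le_trans (fr z)); rewrite -of_real_rnorm ler_piMr//; first exact: ltW.
  by rewrite -(@of_real1 _ s) ler_of_real.
have [x0|x0] := eqVneq (rnorm x) 0.
  by rewrite (rnorm_eq0 x0) linear0 !rnorm0 mulr0.
have xgt0 : 0 < rnorm x by rewrite lt_neqAle eq_sym x0 rnorm_ge0.
have xV : to_real `|of_real (rnorm x)^-1 : scalar_field R s| = (rnorm x)^-1.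
  rewrite ger0_norm ?of_realK// -(@of_real0 _ s) ler_of_real invr_ge0.
  exact: rnorm_ge0.
rewrite -ler_pdivrMr// mulrC -[X in X * _]xV -rnormZ -linearZ.
apply: ub_le_sup => //; exists (of_real (rnorm x)^-1 *: x) => //=.
by rewrite rnormZ xV mulVf.
Qed.

End operator_norm.

Variant index_set := Naturals | Integers.

Definition in_index (J : index_set) : pred int :=
  match J with Naturals => fun k => 1 <= k | Integers => xpredT end.

Definition idx (J : index_set) : countType := {k : int | in_index J k}.

Lemma in_index_succ J k : in_index J k -> in_index J (k + 1).
Proof. by case: J => //= k1; rewrite (le_trans k1)// lerDl. Qed.

Definition idx_next J (k : idx J) : idx J :=
  exist _ (val k + 1) (in_index_succ (valP k)).

Lemma idx_next_inj J : injective (@idx_next J).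
Proof. by move=> k l /(congr1 val) /= /addIr /val_inj. Qed.

Section prod_space.
Context {R : realType} {s : scalars} {J : index_set}.
Local Notation K := (scalar_field R s).
Variable X : idx J -> completeNormedModType K.

Definition prod_space : Type := forall k, X k.

HB.instance Definition _ := gen_eqMixin prod_space.
HB.instance Definition _ := gen_choiceMixin prod_space.

Let add (x y : prod_space) : prod_space := fun k => x k + y k.
Let opp (x : prod_space) : prod_space := fun k => - x k.
Let zero : prod_space := fun k => 0.
Let scale (l : K) (x : prod_space) : prod_space := fun k => l *: x k.

Let addA : associative add.
Proof. by move=> x y z; apply/functional_extensionality_dep => k; exact: addrA. Qed.
Let addC : commutative add.
Proof. by move=> x y; apply/functional_extensionality_dep => k; exact: addrC. Qed.
Let add0 : left_id zero add.
Proof. by move=> x; apply/functional_extensionality_dep => k; exact: add0r. Qed.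
Let addN : left_inverse zero opp add.
Proof. by move=> x; apply/functional_extensionality_dep => k; exact: addNr. Qed.

HB.instance Definition _ := GRing.isZmodule.Build prod_space addA addC add0 addN.

Let scaleA l m x : scale l (scale m x) = scale (l * m) x.
Proof. by apply/functional_extensionality_dep => k; exact: scalerA. Qed.
Let scale1 : left_id 1 scale.
Proof. by move=> x; apply/functional_extensionality_dep => k; exact: scale1r. Qed.
Let scaleDr : right_distributive scale +%R.
Proof. by move=> l x y; apply/functional_extensionality_dep => k; exact: scalerDr. Qed.
Let scaleDl x : {morph scale^~ x : l m / l + m}.
Proof. by move=> l m; apply/functional_extensionality_dep => k; exact: scalerDl. Qed.

HB.instance Definition _ :=
  GRing.Zmodule_isLmodule.Build K prod_space scaleA scale1 scaleDr scaleDl.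

End prod_space.

Section esum_powR.
Context {R : realType} {I : choiceType}.
Implicit Types a b : I -> R.

Definition pow_sum (p : R) a : \bar R := \esum_(k in setT) (a k `^ p)%:E.

Lemma pow_sum_ge0 p a : (0 <= pow_sum p a)%E.
Proof. by apply: esum_ge0 => k _; rewrite lee_fin powR_ge0. Qed.

Lemma le_pow_sum p a b : 0 <= p ->
  (forall k, 0 <= a k <= b k) -> (pow_sum p a <= pow_sum p b)%E.
Proof.
move=> p0 ab; apply: le_esum => k _; have /andP[a0 akb] := ab k.
by rewrite lee_fin ge0_ler_powR// nnegrE// (le_trans a0).
Qed.

Lemma pow_sumZ p (c : R) a : 0 <= c -> (forall k, 0 <= a k) ->
  pow_sum p (fun k => c * a k) = ((c `^ p)%:E * pow_sum p a)%E.
Proof.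
move=> c0 a0; rewrite /pow_sum /esum -ereal_supZl ?powR_ge0//; last first.
  apply/set0P; exists 0%E, set0; first exact: fsets_set0.
  by rewrite fsbig_set0.
congr ereal_sup; rewrite image_comp; apply: eq_imagel => A _ /=.
rewrite ge0_mule_fsumr; last by move=> k; rewrite lee_fin powR_ge0.
by apply: eq_fsbigr => k _; rewrite powRM.
Qed.

Lemma pow_sum_ub p a k : ((a k `^ p)%:E <= pow_sum p a)%E.
Proof.
apply: esum_ge; exists [set k]; first by split.
by rewrite fsbig_set1.
Qed.

Lemma le_pow_sum_inj p a (f : I -> I) : injective f ->
  (pow_sum p (a \o f) <= pow_sum p a)%E.
Proof.
move=> finj; rewrite /pow_sum -(esum_image setT f (fun k => (a k `^ p)%:E)).
  rewrite ge_ereal_sup => //= _ [A [finA _] <-].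
  by apply: ereal_sup_ubound; exists A.
by move=> x y _ _; exact: finj.
Qed.

Lemma minkowski_pow_sum p a b (A B : R) : 1 <= p -> 0 <= A -> 0 <= B ->
  (forall k, 0 <= a k) -> (forall k, 0 <= b k) ->
  (pow_sum p a <= (A `^ p)%:E)%E -> (pow_sum p b <= (B `^ p)%:E)%E ->
  (pow_sum p (fun k => a k + b k)%R <= ((A + B) `^ p)%:E)%E.
Proof.
move=> p1 A0 B0 a0 b0 aA bB.
have p0 : p != 0 by rewrite gt_eqF// (lt_le_trans ltr01).
have eq0 (c : I -> R) : (pow_sum p c <= (0 `^ p)%:E)%E -> c = fun=> 0.
  move=> c0; apply/funext => k; apply: (@powR_eq0_eq0 _ _ p).
  apply/eqP; rewrite eq_le powR_ge0 andbT -lee_fin.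
  by rewrite (le_trans (pow_sum_ub _ _ _))// (le_trans c0)// powR0.
have [A00|An0] := eqVneq A 0.
  rewrite A00 in aA *; rewrite add0r (eq0 _ aA).
  by under eq_fun do rewrite add0r.
have [B00|Bn0] := eqVneq B 0.
  rewrite B00 in bB *; rewrite addr0 (eq0 _ bB).
  by under eq_fun do rewrite addr0.
have Agt0 : 0 < A by rewrite lt_neqAle eq_sym An0.
have Bgt0 : 0 < B by rewrite lt_neqAle eq_sym Bn0.
have ABgt0 : 0 < A + B by rewrite addr_gt0.
pose t := A / (A + B).
have t01 : 0 <= t <= 1.
  by rewrite /t divr_ge0 ?(ltW ABgt0)//= ler_pdivrMr// mul1r lerDl.
have tC : 1 - t = B / (A + B) by rewrite /t; field; rewrite gt_eqF.
have /andP[t0 t1] := t01.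
have tA : A = t * (A + B) by rewrite divfK// gt_eqF.
have tB : B = (1 - t) * (A + B) by rewrite tC divfK// gt_eqF.
clearbody t.
pose c1 := ((A + B) `^ p * t) * A^-1 `^ p.
pose c2 := ((A + B) `^ p * (1 - t)) * B^-1 `^ p.
have c10 : 0 <= c1.
  by rewrite /c1 !mulr_ge0 ?powR_ge0.
have c20 : 0 <= c2.
  by rewrite /c2 !mulr_ge0 ?powR_ge0 ?subr_ge0.
have key k : (a k + b k) `^ p <= c1 * a k `^ p + c2 * b k `^ p.
  have cvx := @convex_powR R p p1 (Itv01 t0 t1)
     (a k / A) (b k / B).
  have /cvx {}cvx : a k / A \in `[0, +oo[%classic.
    by rewrite inE /= in_itv /= andbT divr_ge0// ltW.
  have /cvx {cvx} : b k / B \in `[0, +oo[%classic.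
    by rewrite inE /= in_itv /= andbT divr_ge0// ltW.
  move=> cvx; rewrite convRE [X in X `^ _ <= _]convRE /= in cvx.
  rewrite -[unstable.onem t]/(1 - t) in cvx.
  have -> : a k + b k = (A + B) * (t * (a k / A) + (1 - t) * (b k / B)).
    rewrite mulrDr !mulrA ![(A + B) * _]mulrC -tA -tB.
    by rewrite -!mulrA (mulrCA A) (mulrCA B) !divff// !mulr1.
  rewrite powRM ?(ltW ABgt0)//; last first.
    by rewrite addr_ge0 ?mulr_ge0 ?invr_ge0 ?subr_ge0.
  have -> : c1 * a k `^ p + c2 * b k `^ p =
      (A + B) `^ p * (t * (a k / A) `^ p + (1 - t) * (b k / B) `^ p).
    rewrite !powRM ?invr_ge0// /c1 /c2.
    by move: (_ `^ p) (_ `^ p) (_ `^ p) (_ `^ p) (_ `^ p) => ? ? ? ? ?; ring.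
  by rewrite ler_wpM2l ?powR_ge0.
have sumM (c d : R) (e : I -> R) : 0 <= c -> (forall k, 0 <= e k) ->
  (pow_sum p e <= d%:E)%E ->
  (\esum_(k in setT) (c * e k `^ p)%:E <= (c * d)%:E)%E.
  move=> c0 e0 ed.
  have -> : \esum_(k in [set: I]) (c * e k `^ p)%:E =
     pow_sum p (fun k => c `^ p^-1 * e k).
    apply: eq_esum => k _; rewrite powRM ?powR_ge0//.
    by rewrite -powRrM mulVf// powRr1.
  rewrite pow_sumZ ?powR_ge0// -powRrM mulVf// powRr1// EFinM.
  by rewrite lee_wpmul2l ?lee_fin.
apply: (@le_trans _ _
  (\esum_(k in setT) ((c1 * a k `^ p)%:E + (c2 * b k `^ p)%:E))%E).
  by apply: le_esum => k _; rewrite -EFinD lee_fin.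
rewrite esumD; [|by move=> k _; rewrite lee_fin mulr_ge0 ?powR_ge0..].
apply: (@le_trans _ _ ((c1 * A `^ p)%:E + (c2 * B `^ p)%:E)%E).
  by apply: leeD; apply: sumM.
rewrite -EFinD lee_fin /c1 /c2 -!mulrA -!powRM ?invr_ge0//.
by rewrite !mulVf// powR1 !mulr1 -mulrDr [t + _]addrC subrK mulr1.
Qed.

End esum_powR.

Section lp.
Context {R : realType} {s : scalars} {J : index_set}.
Local Notation K := (scalar_field R s).
Variables (X : idx J -> completeNormedModType K) (p : R).
Implicit Types x y : prod_space X.

Definition lp_pred : {pred prod_space X} :=
  mem [set x : prod_space X | (pow_sum p (fun k => rnorm (x k)) < +oo)%E].

(* [p1] is a parameter of the type because the norm needs it. *)
Record lp (p1 : 1 <= p) := Lp { lp_val :> prod_space X; _ : lp_val \in lp_pred }.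

Variable p1 : 1 <= p.

Let p0 : 0 < p. Proof. exact: lt_le_trans p1. Qed.

Let nm x : R := fine (pow_sum p (fun k => rnorm (x k))) `^ p^-1.

Let nm_ge0 x : 0 <= nm x. Proof. exact: powR_ge0. Qed.

Let nmP x : x \in lp_pred ->
  pow_sum p (fun k => rnorm (x k)) = (nm x `^ p)%:E.
Proof.
rewrite inE /= => xp; rewrite /nm -powRrM mulVf ?gt_eqF// powRr1.
  by rewrite fineK// ge0_fin_numE// pow_sum_ge0.
by rewrite fine_ge0// pow_sum_ge0.
Qed.

Let nm_le x (c : R) : 0 <= c ->
  (pow_sum p (fun k => rnorm (x k)) <= (c `^ p)%:E)%E ->
  x \in lp_pred /\ nm x <= c.
Proof.
move=> c0 xc; have xp : x \in lp_pred.
  by rewrite inE /=; apply: le_lt_trans xc _; rewrite ltry.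
split=> //; rewrite nmP// lee_fin in xc.
move: xc; apply: contraTT; rewrite -!ltNge => cx.
by apply: gt0_ltr_powR; rewrite ?nnegrE.
Qed.

Let nmD x y : x \in lp_pred -> y \in lp_pred ->
  x + y \in lp_pred /\ nm (x + y) <= nm x + nm y.
Proof.
move=> xp yp; apply: nm_le; first by rewrite addr_ge0.
apply: (@le_trans _ _ (pow_sum p (fun k => rnorm (x k) + rnorm (y k)))).
  apply: le_pow_sum; first exact: ltW.
  by move=> k; rewrite rnorm_ge0 ler_rnormD.
by apply: minkowski_pow_sum => //; rewrite -?nmP// => k; exact: rnorm_ge0.
Qed.

Let nmZ (l : K) x : x \in lp_pred ->
  l *: x \in lp_pred /\ nm (l *: x) = to_real `|l| * nm x.
Proof.
move=> xp.
have l0 : 0 <= to_real `|l|.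
  by rewrite -(@ler_of_real _ s) of_real0 to_realK.
have E : pow_sum p (fun k => rnorm ((l *: x) k)) =
    ((to_real `|l| * nm x) `^ p)%:E.
  rewrite (_ : (fun k => _) = fun k => to_real `|l| * rnorm (x k)); last first.
    by apply/funext => k; rewrite -rnormZ.
  rewrite pow_sumZ//; last by move=> k; exact: rnorm_ge0.
  by rewrite nmP// -EFinM powRM.
split; first by rewrite inE /= E ltry.
by rewrite {1}/nm E /= -powRrM mulfV ?gt_eqF// powRr1// mulr_ge0.
Qed.

Lemma lp_submod_closed : submod_closed lp_pred.
Proof.
split=> [|l x y xp yp].
  rewrite inE /= /pow_sum esum1 ?ltry// => k _.
  by rewrite rnorm0 powR0// gt_eqF.
by have [] := nmD (nmZ l xp).1 yp.
Qed.

HB.instance Definition _ :=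
  GRing.isSubmodClosed.Build K (prod_space X) lp_pred lp_submod_closed.
HB.instance Definition _ := [isSub of lp p1 for @lp_val p1].
HB.instance Definition _ := [Choice of lp p1 by <:].
HB.instance Definition _ := [SubChoice_isSubLmodule of lp p1 by <:].

Definition lp_norm (x : lp p1) : R :=
  fine (pow_sum p (fun k => rnorm (lp_val x k))) `^ p^-1.

Let lp_normD (x y : lp p1) :
  of_real (lp_norm (x + y)) <= of_real (lp_norm x) + of_real (lp_norm y) :> K.
Proof.
by rewrite -of_realD ler_of_real; have [] := nmD (valP x) (valP y).
Qed.

Let lp_normZ (l : K) (x : lp p1) :
  of_real (lp_norm (l *: x)) = `|l| * of_real (lp_norm x).
Proof.
rewrite -[`|l|]to_realK// -of_realM; congr of_real.
by have [] := nmZ l (valP x).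
Qed.

Let lp_norm0_eq0 (x : lp p1) : of_real (lp_norm x) = 0 :> K -> x = 0.
Proof.
rewrite -(@of_real0 _ s) => /(can_inj (@of_realK _ s)) x0.
apply/val_inj/functional_extensionality_dep => k; apply: rnorm_eq0.
apply: (@powR_eq0_eq0 _ _ p); apply/eqP; rewrite eq_le powR_ge0 andbT -lee_fin.
apply: (le_trans (pow_sum_ub p (fun k => rnorm (val x k)) k)).
by rewrite (nmP (valP x)) (_ : nm (val x) = 0) ?powR0 ?gt_eqF.
Qed.

HB.instance Definition _ :=
  Lmodule_isNormed.Build K (lp p1) lp_normD lp_normZ lp_norm0_eq0.

End lp.

Section c0.
Context {R : realType} {s : scalars} {J : index_set}.
Local Notation K := (scalar_field R s).
Variable X : idx J -> completeNormedModType K.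
Implicit Types x y : prod_space X.

Definition c0_pred : {pred prod_space X} :=
  mem [set x : prod_space X | forall e : R, 0 < e ->
    exists N : nat, forall k, (N <= `|val k|)%N -> rnorm (x k) < e].

Record c0 := C0 { c0_val :> prod_space X; _ : c0_val \in c0_pred }.

Lemma c0_submod_closed : submod_closed c0_pred.
Proof.
split=> [|l x y]; first by rewrite inE => e e0; exists 0%N => k _; rewrite rnorm0.
rewrite !inE => xp yp e e0.
have l0 : 0 <= to_real `|l|.
  by rewrite -(@ler_of_real _ s) of_real0 to_realK.
have l1 : 0 < to_real `|l| + 1 by rewrite ltr_wpDl.
have [|N xN] := xp (e / 2 / (to_real `|l| + 1)).
  by rewrite !divr_gt0.
have [|M yM] := yp (e / 2); first by rewrite divr_gt0.
exists (maxn N M) => k; rewrite geq_max => /andP[/xN xk /yM yk].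
apply: (le_lt_trans (ler_rnormD _ _)); rewrite [ltRHS]splitr ltrD//.
rewrite rnormZ; apply: (@le_lt_trans _ _ ((to_real `|l| + 1) * rnorm (x k))).
  by rewrite ler_wpM2r ?rnorm_ge0// lerDl.
by rewrite mulrC -ltr_pdivlMr.
Qed.

HB.instance Definition _ :=
  GRing.isSubmodClosed.Build K (prod_space X) c0_pred c0_submod_closed.
HB.instance Definition _ := [isSub for c0_val].
HB.instance Definition _ := [Choice of c0 by <:].
HB.instance Definition _ := [SubChoice_isSubLmodule of c0 by <:].

Definition c0_norm (x : c0) : R := sup [set rnorm (c0_val x k) | k in setT].

Let c0_norm_ub (x : c0) k : rnorm (c0_val x k) <= c0_norm x.
Proof.
apply: ub_le_sup; last by exists k.
have := valP x; rewrite inE => /(_ 1 ltr01)[N xN].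
pose f (i : 'I_(N + N)) : R :=
  oapp (fun k => rnorm (val x k)) 0 (insub (i%:Z - N%:Z)).
have f0 i : 0 <= f i by rewrite /f; case: insub => //= l; exact: rnorm_ge0.
exists (1 + \sum_i f i) => _ [l _ <-].
have [/xN xl|lN] := leqP N `|val l|%N.
  by rewrite (le_trans (ltW xl))// lerDl sumr_ge0.
have li : (`|(val l + N%:Z)%R| < N + N)%N by lia.
rewrite (bigD1 (Ordinal li))//= addrCA.
have -> : f (Ordinal li) = rnorm (val x l).
  rewrite /f /= (_ : `|(val l + N%:Z)%R|%N%:Z - N%:Z = val l); last by lia.
  by rewrite valK.
by rewrite lerDl addr_ge0// sumr_ge0.
Qed.

Let c0_norm_le (x : c0) (c : R) :
  (forall k, rnorm (c0_val x k) <= c) -> c0_norm x <= c.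
Proof.
move=> xc; apply: ge_sup; last by move=> _ [k _ <-].
have k : idx J by exists 1; case: (J).
by exists (rnorm (c0_val x k)), k.
Qed.

Let c0_normD (x y : c0) :
  of_real (c0_norm (x + y)) <= of_real (c0_norm x) + of_real (c0_norm y) :> K.
Proof.
rewrite -of_realD ler_of_real; apply: c0_norm_le => k.
by apply: (le_trans (ler_rnormD _ _)); rewrite lerD.
Qed.

Let c0_normZ_le (l : K) (x : c0) :
  c0_norm (l *: x) <= to_real `|l| * c0_norm x.
Proof.
apply: c0_norm_le => k; rewrite (rnormZ l (c0_val x k)) ler_wpM2l//.
by rewrite -(@ler_of_real _ s) of_real0 to_realK.
Qed.

Let c0_normZ (l : K) (x : c0) :
  of_real (c0_norm (l *: x)) = `|l| * of_real (c0_norm x).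
Proof.
rewrite -[`|l|]to_realK// -of_realM; congr of_real.
apply/eqP; rewrite eq_le c0_normZ_le/=.
have [->|l0] := eqVneq l 0.
  rewrite normr0 -(@of_real0 _ s) of_realK mul0r.
  have k : idx J by exists 1; case: (J).
  exact: le_trans (rnorm_ge0 _) (c0_norm_ub _ k).
have lgt0 : 0 < to_real `|l|.
  rewrite lt_neqAle eq_sym -(@ler_of_real _ s) of_real0 to_realK//.
  rewrite normr_ge0 andbT; apply: contra_neq l0 => l0.
  by apply/normr0_eq0; rewrite -[LHS]to_realK// l0 of_real0.
rewrite mulrC -ler_pdivlMr// mulrC -{1}[x](scalerK l0).
apply: (le_trans (c0_normZ_le _ _)).
rewrite (_ : to_real `|l^-1| = (to_real `|l|)^-1)//.
apply: (mulfI (lt0r_neq0 lgt0)); rewrite mulfV ?gt_eqF//.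
apply: (can_inj (@of_realK _ s)).
by rewrite of_realM !to_realK// -normrM mulfV// normr1 of_real1.
Qed.

Let c0_norm0_eq0 (x : c0) : of_real (c0_norm x) = 0 :> K -> x = 0.
Proof.
rewrite -(@of_real0 _ s) => /(can_inj (@of_realK _ s)) x0.
apply/val_inj/functional_extensionality_dep => k; apply: rnorm_eq0.
by apply/eqP; rewrite eq_le rnorm_ge0 andbT -x0 c0_norm_ub.
Qed.

HB.instance Definition _ :=
  Lmodule_isNormed.Build K c0 c0_normD c0_normZ c0_norm0_eq0.

End c0.

Arguments lp_pred {R s J X} p.
Arguments c0_pred {R s J X}.

Section shift.
Context {R : realType} {s : scalars} {J : index_set}.
Local Notation K := (scalar_field R s).
Variable X : idx J -> completeNormedModType K.

(* [T k] stands for T_{k+1} : X_{k+1} -> X_k, so that k + 1 ranges over J^*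
   when k ranges over J. *)
Variable T : forall k : idx J, {linear X (idx_next k) -> X k}.

Definition backward_shift (x : prod_space X) : prod_space X :=
  fun k => T k (x (idx_next k)).

Definition uniformly_bounded : Prop :=
  (forall k, continuous (T k)) /\ has_ubound [set opnorm (T k) | k in setT].

Lemma uniformly_boundedP : uniformly_bounded ->
  exists2 M : R, 0 <= M & forall k x, rnorm (T k x) <= M * rnorm x.
Proof.
case=> cT [M ubM]; exists (Num.max 0 M) => [|k x]; first by rewrite le_max lexx.
apply: (le_trans (opnormP x (cT k))); rewrite ler_wpM2r ?rnorm_ge0//.
by rewrite le_max ubM ?orbT//; exists k.
Qed.

Hypothesis bT : uniformly_bounded.

Lemma lp_shift_closed (p : R) (x : prod_space X) : 1 <= p ->
  x \in lp_pred p -> backward_shift x \in lp_pred p.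
Proof.
move=> p1; have [M M0 TM] := uniformly_boundedP bT.
rewrite !inE /= => xp.
apply: (@le_lt_trans _ _ (pow_sum p (fun k => M * rnorm (x (idx_next k))))).
  apply: le_pow_sum; first exact: le_trans p1.
  by move=> k; rewrite rnorm_ge0 TM.
rewrite pow_sumZ//; last by move=> k; exact: rnorm_ge0.
rewrite lte_mul_pinfty ?lee_fin ?powR_ge0//.
exact: le_lt_trans (le_pow_sum_inj _ _ (@idx_next_inj J)) xp.
Qed.

Lemma c0_shift_closed (x : prod_space X) :
  x \in c0_pred -> backward_shift x \in c0_pred.
Proof.
have [M M0 TM] := uniformly_boundedP bT.
rewrite !inE /= => xp e e0.
have M1 : 0 < M + 1 by rewrite ltr_wpDl.
have [|N xN] := xp (e / (M + 1)); first by rewrite divr_gt0.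
exists N.+1 => k Nk; apply: (le_lt_trans (TM _ _)).
apply: (@le_lt_trans _ _ ((M + 1) * rnorm (x (idx_next k)))).
  by rewrite ler_wpM2r ?rnorm_ge0// lerDl.
by rewrite mulrC -ltr_pdivlMr//; apply: xN => /=; lia.
Qed.

Definition lp_shift (p : R) (p1 : 1 <= p) (x : lp X p1) : lp X p1 :=
  Lp p1 (lp_shift_closed p1 (valP x)).

Definition c0_shift (x : c0 X) : c0 X := C0 (c0_shift_closed (valP x)).

End shift.

Arguments lp_shift {R s J X T} bT {p} p1 x.
Arguments c0_shift {R s J X T} bT x.

Section dynamics.
Context {R : realType} {s : scalars} {Y : normedModType (scalar_field R s)}.
Variable S : Y -> Y.

Definition hypercyclic : Prop :=
  exists y, dense [set iter n S y | n in [set: nat]].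

Definition periodic_points : set Y :=
  [set y | exists2 d : nat, (1 <= d)%N & iter d S y = y].

Definition chaotic : Prop := hypercyclic /\ dense periodic_points.

Definition lower_density (A : set nat) : \bar R :=
  limn_einf (fun N => (#|[pred n : 'I_N.+1 | (n : nat) \in A]|%:R / N.+1%:R)%:E).

Definition frequently_hypercyclic : Prop :=
  exists y, forall U : set Y, open U -> U !=set0 ->
    (0 < lower_density [set n | iter n S y \in U])%E.

End dynamics.

(* Main.v *)
(* Call B the shift, on sequences over J. Let x be periodic for B and let k be
   in J. Reading suitable iterates of x along the coordinates gives a fixed
   point z of B, still in the space, with z_k = x_k. Hence, if B is chaotic,
   then for each k the k-th coordinates of the fixed points are dense in X_k.

   Given a family of fixed points Z^j, j in J, the diagonal sequence
   y_j = Z^j_j satisfies (B^n y)_i = Z^(i+n)_i. To get a frequently hypercyclic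
   y, choose countably many finite patterns of fixed points, whose diagonals
   approximate a dense sequence of the space, and take Z to be a copy of the
   l-th pattern around each point of a set A_l of positive lower density, and 0
   elsewhere. For n in A_l the iterate B^n y then agrees with the l-th diagonal
   near 0. Its other coordinates come from tails of the fixed points, and they
   stay below one fixed sequence of the space if the sets A_l are sufficiently
   separated. *)
Require Import Defs.
From HB Require Import structures.
From mathcomp Require Import all_boot all_order all_algebra.
From mathcomp Require Import all_classical all_reals all_analysis.
From mathcomp Require Import zify lra.
Import Order.TTheory GRing.Theory Num.Theory.
Import numFieldNormedType.Exports.

Set Implicit Arguments.
Unset Strict Implicit.
Unset Printing Implicit Defensive.

(** * Separated sets of indices with positive lower density *)

Lemma sum_divn_pow2 (n m : nat) : \sum_(l < m) n %/ 2 ^ l <= 2 * n.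
Proof.
elim: m n => [|m IH] n; first by rewrite big_ord0.
rewrite big_ord_recl expn0 divn1.
have -> : \sum_(i < m) n %/ 2 ^ lift ord0 i = \sum_(i < m) (n %/ 2) %/ 2 ^ i.
  by apply: eq_bigr => i _; rewrite /= /bump /= add1n expnS divnMA.
have := IH (n %/ 2); have := leq_trunc_div n 2; lia.
Qed.

Lemma pow2_odd_inj (a b q r : nat) :
  2 ^ a * (2 * q + 1) = 2 ^ b * (2 * r + 1) -> a = b /\ q = r.
Proof.
elim: a b => [|a IH] [|b]; rewrite ?expn0 ?expnS ?mul1n -?mulnA.
- by lia.
- by lia.
- by lia.
by move=> h; have [-> ->] : a = b /\ q = r by apply: IH; lia.
Qed.

(** The values of [f l] form the set A_l: linear growth yields positive lower density. A gap depends
    on the types of both its end points, since each pattern has its own radius. *)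
Lemma separated_sequences (N : nat -> nat) : exists f : nat -> nat -> nat,
  [/\ forall l, exists C, forall q, f l q <= C * q.+1,
      forall l q, N l <= f l q &
      forall l q l' q', (l, q) <> (l', q') ->
        f l q <= f l' q' -> f l q + (N l + N l') <= f l' q'].
Proof.
(* The summands [(N i).+1] make [e l] at least N l + l, so that N l / 2^(e l) <= 2^-l, and strictly
   increasing in l, so that the power of 2 in an index determines its type. *)
pose e l := \sum_(i < l.+1) (N i).+1.
have eS l : e l.+1 = e l + (N l.+1).+1 by rewrite /e big_ord_recr.
have e_ge l : N l + l <= e l.
  by elim: l => [|l]; rewrite ?eS /e ?big_ord_recr ?big_ord0 //=; lia.
have e_mono l l' : l < l' -> e l < e l'.
  elim: l' => // l' IH; rewrite eS ltnS leq_eqVlt => /orP[/eqP ->|/IH]; lia.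
have e_inj : injective e.
  by move=> l l' ell; have := @e_mono l l'; have := @e_mono l' l; lia.
(* 2^(e l) (2q + 1) is the q-th index of type l. The steps of [psi] into the
   multiples of 2^(e l) are at least N l; [psi] still grows linearly because
   N l / 2^(e l) is summable. *)
pose psi n := \sum_(l < n.+1) N l * (n %/ 2 ^ e l).
(* The terms with l > n vanish because 2^(e l) > n, so values of [psi] can be compared as sums over
   one range. *)
have psi_wide n m : n <= m -> psi n = \sum_(l < m.+1) N l * (n %/ 2 ^ e l).
  move=> nm; rewrite /psi -!(big_mkord xpredT (fun l => N l * (n %/ 2 ^ e l))).
  rewrite [RHS](@big_cat_nat _ _ _ n.+1) //.
  rewrite [X in _ = _ + X]big_nat_cond [X in _ = _ + X]big1 ?addn0// => l.
  rewrite andbT => /andP[nl _]; rewrite divn_small ?muln0//.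
  by have := e_ge l; have := ltn_expl (e l) (isT : 1 < 2); lia.
have psi_le n : psi n <= 2 * n.
  apply: leq_trans (sum_divn_pow2 n n.+1); apply: leq_sum => l _.
  have -> : 2 ^ e l = 2 ^ l * 2 ^ (e l - l).
    by rewrite -expnD; congr (2 ^ _); have := e_ge l; lia.
  rewrite divnMA mulnC; apply: leq_trans (leq_trunc_div _ (2 ^ (e l - l))).
  rewrite leq_mul2l; apply/orP; right.
  apply: leq_trans (ltnW (ltn_expl _ (isT : 1 < 2))) _.
  by rewrite leq_exp2l//; have := e_ge l; lia.
have psi_mono n m : n <= m -> psi n <= psi m.
  move=> nm; rewrite (psi_wide _ _ nm); apply: leq_sum => l _.
  by rewrite leq_mul2l leq_div2r ?orbT.
have psi_jump l b : 0 < b -> psi (2 ^ e l * b).-1 + N l <= psi (2 ^ e l * b).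
  move=> b0; have p0 : 0 < 2 ^ e l by rewrite expn_gt0.
  set n := 2 ^ e l * b; have n0 : 0 < n by rewrite muln_gt0 p0.
  have ln : l < n.+1.
    rewrite ltnS (leq_trans (leq_trans (leq_addl _ _) (e_ge l)))//.
    by rewrite (leq_trans (ltnW (ltn_expl _ (isT : 1 < 2))))// leq_pmulr.
  rewrite (psi_wide _ _ (leq_pred n)) /psi.
  rewrite (bigD1 (Ordinal ln))//= [leqRHS](bigD1 (Ordinal ln))//=.
  rewrite addnAC leq_add//.
    rewrite -mulnSr leq_mul2l; apply/orP; right.
    by rewrite {2}/n mulKn// ltn_divLR// (mulnC b) -/n ltn_predL.
  by apply: leq_sum => i _; rewrite leq_mul2l leq_div2r ?orbT ?leq_pred.
pose pos l q := 2 ^ e l * (2 * q + 1).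
have pos0 l q : 0 < pos l q by rewrite muln_gt0 expn_gt0 addn1.
(* The shifted copy of [psi] steps up right after a point of type l, so that
   gaps are large on both sides. *)
exists (fun l q => psi (pos l q) + psi (pos l q).-1); split.
- move=> l; exists (8 * 2 ^ e l) => q.
  apply: (@leq_trans (4 * pos l q)); last by rewrite /pos; nia.
  by have := psi_le (pos l q); have := psi_mono _ _ (leq_pred (pos l q)); lia.
- by move=> l q; have := @psi_jump l (2 * q + 1); rewrite -/(pos l q); lia.
- move=> l q l' q' ne.
  have jump i r : psi (pos i r).-1 + N i <= psi (pos i r) by apply: psi_jump; lia.
  have := jump l q; have := jump l' q'; have := pos0 l q; have := pos0 l' q'.
  case: (ltngtP (pos l q) (pos l' q')) => [lt|lt|eq]; last first.
  + by case: (pow2_odd_inj eq) => /e_inj ll qq; case: ne; rewrite ll qq.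
  + move=> _ _ j' j; have := psi_mono (pos l' q') (pos l q).-1 ltac:(lia).
    by have := psi_mono (pos l' q').-1 (pos l q).-1 ltac:(lia); lia.
  + move=> _ _ j' j; have := psi_mono (pos l q) (pos l' q').-1 ltac:(lia).
    by have := psi_mono (pos l q).-1 (pos l' q').-1 ltac:(lia); lia.
Qed.

Local Open Scope classical_set_scope.
Local Open Scope ring_scope.

(** The first N / C values of [f] (rounded down) are at most N, so [0, N] contains that many points
    of [A]; for N >= C this is at least (N + 1) / (2C). *)
Lemma lower_density_gt0 (R : realType) (A : set nat) (f : nat -> nat) (C : nat) :
  injective f -> (forall q, f q \in A) -> (forall q, (f q <= C * q.+1)%N) ->
  (0 < @lower_density R A)%E.
Proof.
move=> finj fA fC.
have C0 : (0 < C)%N.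
  case: C fC => // f0; have f0' q : f q = 0%N by have := f0 q; lia.
  by have /finj := etrans (f0' 0%N) (esym (f0' 1%N)).
apply: (@lt_le_trans _ _ ((2 * C)%:R^-1)%:E).
  by rewrite lte_fin invr_gt0 ltr0n muln_gt0.
rewrite /lower_density limn_einf_lim.
apply: lime_ge; first exact: is_cvg_einfs.
exists C => //= n /= Cn; apply: le_ereal_inf_tmp => _ [N /= nN <-].
rewrite lee_fin ler_pdivlMr ?ltr0n// ler_pdivrMl ?ltr0n ?muln_gt0//.
rewrite -natrM ler_nat.
suff H : (N %/ C <= #|[pred i : 'I_N.+1 | (i : nat) \in A]|)%N.
  have := divn_eq N C; have := ltn_mod N C; rewrite C0 => h1 h2.
  have : (0 < N %/ C)%N by rewrite divn_gt0//; lia.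
  nia.
have fN (i : 'I_(N %/ C)) : (f i < N.+1)%N.
  rewrite ltnS (leq_trans (fC i))// mulnC.
  by rewrite (leq_trans _ (leq_divM N C))// leq_mul2r ltn_ord orbT.
rewrite -[leqLHS]card_ord -(@card_imset _ _ (fun i => Ordinal (fN i))).
  apply: subset_leq_card; apply/fintype.subsetP => _ /imsetP[i _ ->].
  exact: fA.
by move=> i j /(congr1 val) /= /finj /val_inj.
Qed.

(** * Open and dense sets in terms of the real-valued norm *)

Section real_norm_topology.
Context {R : realType} {s : scalars} {V : normedModType (scalar_field R s)}.
Implicit Types x y : V.

Lemma ltr_of_real : {mono (@of_real R s) : x y / x < y}.
Proof. exact: leW_mono (@ler_of_real R s). Qed.

Lemma rnormN x : rnorm (- x) = rnorm x.
Proof. by rewrite /rnorm normrN. Qed.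

Lemma ler_rnormB x y : rnorm (x - y) <= rnorm x + rnorm y.
Proof. by rewrite -(rnormN y) ler_rnormD. Qed.

Lemma open_rnormP (U : set V) x : open U -> U x ->
  exists2 e : R, 0 < e & forall y, rnorm (y - x) < e -> U y.
Proof.
move=> oU Ux; have /nbhs_ballP[e /= e0 eU] : nbhs x U by exact: open_nbhs_nbhs.
have eE : of_real (to_real e) = e by rewrite to_realK// ltW.
exists (to_real e) => [|y xy]; first by rewrite -ltr_of_real of_real0 eE.
apply: eU; rewrite -ball_normE /ball_ /= -normrN opprB -of_real_rnorm -eE.
by rewrite ltr_of_real.
Qed.

Lemma dense_rnorm (A : set V) x (e : R) : dense A -> 0 < e ->
  exists2 y, A y & rnorm (y - x) < e.
Proof.
move=> dA e0; have e0' : 0 < of_real e :> scalar_field R s.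
  by rewrite -(@of_real0 R s) ltr_of_real.
have [|y [+ Ay]] := dA (ball x (of_real e)) _ (ball_open _ _).
  by exists x; exact: ballxx.
rewrite -ball_normE /ball_ /= -normrN opprB -of_real_rnorm ltr_of_real => xy.
by exists y.
Qed.

End real_norm_topology.

(** * Indices, diagonals and fixed points of the shift *)

Lemma index_ball_finite (J : index_set) (L : nat) :
  exists r : seq (idx J), forall k, (`|val k| < L)%N -> k \in r.
Proof.
exists (pmap insub [seq i%:Z - L%:Z | i <- iota 0 (L + L)]) => k kL.
rewrite mem_pmap_sub; apply/mapP; set m := val k in kL *.
by exists `|(m + L%:Z)%R|%N; rewrite ?mem_iota; lia.
Qed.

Lemma val_iter_next (J : index_set) n (k : idx J) :
  val (iter n (@idx_next J) k) = val k + n%:Z.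
Proof. by elim: n => [|n IH] /=; [rewrite addr0 | rewrite IH -addrA -PoszD addn1]. Qed.

Section shift_orbits.
Context {R : realType} {s : scalars} {J : index_set}.
Context {X : idx J -> completeNormedModType (scalar_field R s)}.
Variable T : forall k : idx J, {linear X (idx_next k) -> X k}.
Local Notation B := (backward_shift T).

(** In a fixed sequence [T k] maps the coordinate k + 1 to the coordinate k. So each shift advances
    the index of the fixed point by one and keeps the coordinate. *)
Lemma iter_shift_diagonal (Z : idx J -> prod_space X) n :
  (forall k, B (Z k) = Z k) ->
  iter n B (fun k => Z k k) = fun k => Z (iter n (@idx_next J) k) k.
Proof.
move=> BZ; elim: n => //= n IH; rewrite IH.
apply/functional_extensionality_dep => k.
by rewrite /backward_shift -iterSr -[in RHS]BZ.
Qed.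

(** A fixed point through x_k should have the j-th coordinate of B^(k - j) x; the residue modulo the
    period [d] gives this exponent a meaning for j > k. *)
Definition backward_orbit (d : nat) (x : prod_space X) (k : idx J) :
    prod_space X :=
  fun j => iter `|((val k - val j) %% d%:Z)%Z|%N B x j.

(** The shift raises the exponent (k - j - 1) mod d by one. This gives (k - j) mod d, except when d
    - 1 becomes d, where B^d x = x. *)
Lemma backward_orbit_fixed d x k : (0 < d)%N -> iter d B x = x ->
  B (backward_orbit d x k) = backward_orbit d x k.
Proof.
move=> d0 dx; apply/functional_extensionality_dep => j.
rewrite /backward_shift /backward_orbit /=.
set m := (val k - val j : int).
have -> : val k - (val j + 1) = m - 1 by rewrite /m; lia.
rewrite -[LHS]/(iter `|((m - 1) %% d%:Z)%Z|.+1 B x j).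
have dz : (d%:Z != 0) by lia.
have r0 := modz_ge0 m dz; have rd : (m %% d%:Z)%Z < d%:Z by apply: ltz_pmod; lia.
have mE := divz_eq m d%:Z; set q := (m %/ d%:Z)%Z in mE.
set r := (m %% d%:Z)%Z in r0 rd mE *; clearbody q r.
have [r1|r1] := leP 1 r.
  have -> : ((m - 1) %% d%:Z)%Z = r - 1.
    by rewrite mE -addrA modzMDl modz_small//; lia.
  by have -> : `|(r - 1)%R|.+1 = `|r|%N by lia.
have {r1 r0}r0 : r = 0 by lia.
have -> : ((m - 1) %% d%:Z)%Z = d%:Z - 1.
  have -> : m - 1 = (q - 1) * d%:Z + (d%:Z - 1) by rewrite mE r0; lia.
  by rewrite modzMDl modz_small//; lia.
have -> : `|(d%:Z - 1)%R|.+1 = d by lia.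
by rewrite dx r0.
Qed.

Lemma backward_orbit_id d x k : backward_orbit d x k k = x k.
Proof. by rewrite /backward_orbit subrr mod0z. Qed.

End shift_orbits.

(** * Abstract sequence spaces and the dynamical argument *)

Section majorants.
Context {R : realType} {J : index_set}.

(* E stands for the sequences of norms of the elements of an l^p or c_0 sum. *)
Record majorant_class (E : (idx J -> R) -> Prop) : Prop := {
  majorant_ge0 : forall a, E a -> forall i, 0 <= a i;
  majorant0 : E (fun=> 0);
  majorant_le : forall a b, E b -> (forall i, 0 <= a i <= b i) -> E a;
  majorantD : forall a b, E a -> E b -> E (fun i => a i + b i);
  majorant_dominate : forall a : nat -> idx J -> R, (forall l, E (a l)) ->
    exists2 G, E G & forall l, exists M : nat, forall i, (M <= `|val i|)%N ->
      a l i <= G i }.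

Lemma finite_majorant (E : (idx J -> R) -> Prop) (I : eqType) (r : seq I)
    (a : I -> idx J -> R) : majorant_class E -> (forall i, E (a i)) ->
  exists2 b, E b & forall i, i \in r -> forall j, a i j <= b j.
Proof.
move=> hE Ea; elim: r => [|i r [b Eb rb]].
  by exists (fun=> 0) => //; exact: majorant0.
exists (fun j => a i j + b j); first exact: majorantD.
move=> i'; rewrite inE => /predU1P[->|/rb ib] j.
  by rewrite lerDl (majorant_ge0 hE).
by rewrite (le_trans (ib j))// lerDr (majorant_ge0 hE).
Qed.

End majorants.

Section sequence_space.
Context {R : realType} {s : scalars} {J : index_set}.
Context {X : idx J -> completeNormedModType (scalar_field R s)}.
Variable T : forall k : idx J, {linear X (idx_next k) -> X k}.
Context {Y : normedModType (scalar_field R s)}.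
Local Notation B := (backward_shift T).

(** What the argument uses of l^p and c_0, with [v] giving the coordinates. The field [seqsp_small]
    plays the role of dominated convergence. *)
Record sequence_space (E : (idx J -> R) -> Prop) (v : Y -> prod_space X) :
    Prop := {
  seqspB : forall x y k, v (x - y) k = v x k - v y k;
  seqsp_majorant : forall y, E (fun k => rnorm (v y k));
  seqsp_surj : forall x : prod_space X, E (fun k => rnorm (x k)) ->
    exists y, v y = x;
  seqsp_coord : forall y k, rnorm (v y k) <= rnorm y;
  seqsp_small : forall H (e : R), E H -> 0 < e ->
    exists L : nat, exists2 d : R, 0 < d &
      forall y, (forall k, (`|val k| < L)%N -> rnorm (v y k) <= d) ->
        (forall k, (L <= `|val k|)%N -> rnorm (v y k) <= H k) -> rnorm y < e }.

Context {E : (idx J -> R) -> Prop} {v : Y -> prod_space X} {S : Y -> Y}.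
Hypothesis hE : majorant_class E.
Hypothesis hv : sequence_space E v.
Hypothesis vS : forall y, v (S y) = B (v y).

Let v_iter n y : v (iter n S y) = iter n B (v y).
Proof. by elim: n => //= n IH; rewrite vS IH. Qed.

(** Each coordinate is taken from one of the first [d] iterates, so a common majorant of these
    finitely many sequences suffices. *)
Lemma backward_orbit_majorant d y k : (0 < d)%N ->
  E (fun j => rnorm (backward_orbit T d (v y) k j)).
Proof.
move=> d0.
have [|b Eb yb] := @finite_majorant _ _ _ _ (iota 0 d)
  (fun r j => rnorm (v (iter r S y) j)) hE.
  by move=> r; exact: seqsp_majorant hv _.
apply: (majorant_le hE Eb) => j; rewrite rnorm_ge0 /= /backward_orbit -v_iter.
apply: yb; rewrite mem_iota add0n /=.
have dz : (d%:Z != 0) by lia.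
have := modz_ge0 (val k - val j) dz.
have : ((val k - val j) %% d%:Z)%Z < d%:Z by apply: ltz_pmod; lia.
by set m := (_ %% _)%Z; lia.
Qed.

Lemma fixed_points_dense_coordinates y k (e : R) :
  dense (periodic_points S) -> 0 < e ->
  exists z : prod_space X, [/\ B z = z, E (fun j => rnorm (z j)) &
    rnorm (z k - v y k) < e].
Proof.
move=> dS e0; have [x [d d0 dx] xy] := dense_rnorm y dS e0.
exists (backward_orbit T d (v x) k); split.
- by apply: backward_orbit_fixed => //; rewrite -v_iter dx.
- exact: backward_orbit_majorant.
- rewrite backward_orbit_id -(seqspB hv).
  exact: le_lt_trans (seqsp_coord hv _ _) xy.
Qed.

Lemma chaotic_frequently_hypercyclic : chaotic S -> frequently_hypercyclic S.
Proof.
move=> [[y0 dy0] dS].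
(* The pattern l has radius L l and approximates the (j l)-th iterate of y0 on
   each coordinate up to 1 / (t l + 1). *)
pose dec (l : nat) : nat * nat * nat := odflt (0, 0, 0)%N (unpickle l).
pose L l := (dec l).1.1; pose j l := (dec l).1.2; pose t l := (dec l).2.
have /choice[z zP] : forall lk : nat * idx J, exists w : prod_space X,
    [/\ B w = w, E (fun i => rnorm (w i)) &
      rnorm (w lk.2 - v (iter (j lk.1) S y0) lk.2) < (t lk.1).+1%:R^-1].
  move=> lk; apply: fixed_points_dense_coordinates => //.
have /choice[a aP] : forall l, exists al : idx J -> R, E al /\
    forall k, (`|val k| < L l)%N -> forall i, rnorm (z (l, k) i) <= al i.
  move=> l.
  have [r rP] := index_ball_finite J (L l).
  have [|b Eb zb] := @finite_majorant _ _ _ _ r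
    (fun k i => rnorm (z (l, k) i)) hE.
    by move=> k; have [] := zP (l, k).
  by exists b; split=> // k /rP kr i; exact: zb.
have [G EG aG] := majorant_dominate hE (fun l => (aP l).1).
have /choice[M MP] := aG.
(* The part [L l] of the gaps keeps the copies of the patterns disjoint. The part [M l] makes a copy
   around another point visible only at coordinates where [G] dominates its fixed points. *)
have [f [f_lin f_ge f_sep]] := separated_sequences (fun l => M l + L l + 1)%N.
pose covers l q (k i : idx J) :=
  (`|val k| < L l)%N /\ val i = val k + (f l q)%:Z.
have Zex (i : idx J) : exists w : prod_space X,
    (w = 0 /\ ~ exists l q k, covers l q k i) \/
    exists l q k, covers l q k i /\ w = z (l, k).
  have [[l [q [k lqk]]]|no] := pselect (exists l q k, covers l q k i).
    by exists (z (l, k)); right; exists l, q, k.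
  by exists 0; left.
have [Z ZP] := choice Zex.
have BZ i : B (Z i) = Z i.
  have [[-> _]|[l [q [k [_ ->]]]]] := ZP i; last by have [] := zP (l, k).
  by apply/functional_extensionality_dep => k; exact: linear0.
(* This bounds the coordinate [i] of the n-th iterate of the diagonal: it vanishes or comes from a
   pattern whose [M l] is at most |i|. *)
have Zfar n (i : idx J) : (forall l q (k : idx J), (`|val k| < L l)%N ->
    
    val i + n%:Z = val k + (f l q)%:Z -> (M l <= `|val i|)%N) ->
    rnorm (Z (iter n (@idx_next J) i) i) <= G i.
  move=> far; have [[-> _]|[l [q [k [[kL +] ->]]]]] := ZP (iter n (@idx_next J) i).
    by rewrite rnorm0 (majorant_ge0 hE).
  rewrite val_iter_next => ik.
  by rewrite (le_trans ((aP l).2 k kL i))// MP// (far _ _ _ kL ik).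
(* No other copy meets the one around [f l q], so the choice made in [Z] is forced there. *)
have Znear l q (i : idx J) : (`|val i| < L l)%N ->
    Z (iter (f l q) (@idx_next J) i) = z (l, i).
  move=> iL; have [[_ []]|] := ZP (iter (f l q) (@idx_next J) i).
    by exists l, q, i; split; rewrite ?val_iter_next.
  move=> [l' [q' [k [[kL +] ->]]]]; rewrite val_iter_next => ik.
  have [[ll qq]|ne] := pselect ((l, q) = (l', q')).
    by congr (z (_, _)); [|apply: val_inj; move: ik; rewrite ll qq => /addIr].
  exfalso; have := f_sep _ _ _ _ ne; have := f_sep _ _ _ _ (nesym ne).
  set m := val i in ik iL; set m' := val k in ik kL.
  by case: (leqP (f l q) (f l' q')) => h; [move=> _|move=> + _]; lia.
(* At time 0 the lower bound on [f] puts every copy beyond its radius [M l], so [G] dominates the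
   whole diagonal. *)
have [|y vy] := seqsp_surj hv (x := fun i => Z i i).
  apply: (majorant_le hE EG) => i; rewrite rnorm_ge0 /=.
  apply: (Zfar 0%N i) => l q k kL; rewrite addr0; have := f_ge l q.
  by set m := val i; set m' := val k in kL * => h1 h2; lia.
exists y => U oU [p Up].
have [e e0 eU] := open_rnormP oU Up.
(* This majorant serves the difference of an iterate and [p]: [G] bounds the far coordinates of the
   iterate. *)
have EH := majorantD hE EG (seqsp_majorant hv p).
have [L0 [d d0 small]] := seqsp_small hv EH e0.
(* One half of [d] is for the distance from [p] to an iterate of [y0], the other for the
   approximation of that iterate by the pattern. *)
have d2 : 0 < d / 2 by rewrite divr_gt0.
have [_ [j0 _ <-] j0P] := dense_rnorm p dy0 d2.
have [t0 t0P] : exists t0 : nat, t0.+1%:R^-1 < d / 2.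
  by have [t0 t0P] := ltr_add_invr d2; exists t0; rewrite add0r in t0P.
pose l := pickle (L0, j0, t0).
have Ll : L l = L0 by rewrite /L /dec /l pickleK.
have jl : j l = j0 by rewrite /j /dec /l pickleK.
have tl : t l = t0 by rewrite /t /dec /l pickleK.
have [C fC] := f_lin l.
have f_inj : injective (f l).
  move=> q q' qq; apply: contrapT => ne.
  have := f_sep l q l q' ltac:(by case); lia.
apply: (lower_density_gt0 R f_inj _ fC) => q.
rewrite inE /= inE; apply: eU; apply: small => k kL; rewrite (seqspB hv).
  rewrite v_iter vy iter_shift_diagonal// Znear ?Ll//.
  rewrite -[z _ k](subrK (v (iter j0 S y0) k)) -addrA.
  rewrite (le_trans (ler_rnormD _ _))// [leRHS]splitr lerD//.
    by have [_ _] := zP (l, k); rewrite /= jl tl => /ltW/le_trans; apply; exact: ltW.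
  by rewrite -(seqspB hv) (le_trans (seqsp_coord hv _ _))// ltW.
rewrite v_iter vy iter_shift_diagonal// (le_trans (ler_rnormB _ _))// lerD2r.
apply: Zfar => l' q' k' k'L.
have [[ll qq]|ne] := pselect ((l, q) = (l', q')).
  rewrite -ll -qq => /addIr kk; move: k'L kL; rewrite -ll kk Ll.
  by set m := val k'; lia.
have := f_sep _ _ _ _ ne; have := f_sep _ _ _ _ (nesym ne); rewrite Ll.
set m := val k in kL *; set m' := val k' in k'L *.
by case: (leqP (f l q) (f l' q')) => h; [move=> _|move=> + _]; lia.
Qed.

End sequence_space.

(** * The space c_0 *)

Section c0_sequences.
Context {R : realType} {s : scalars} {J : index_set}.
Context {X : idx J -> completeNormedModType (scalar_field R s)}.

Definition c0_majorant (a : idx J -> R) : Prop :=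
  (forall i, 0 <= a i) /\
  forall e : R, 0 < e -> exists N : nat, forall i, (N <= `|val i|)%N -> a i < e.

Lemma c0_majorant_class : majorant_class c0_majorant.
Proof.
split.
- by move=> a [].
- by split=> // e e0; exists 0%N.
- move=> a b [b0 bE] ab; split=> [i|e e0]; first by have /andP[] := ab i.
  have [N bN] := bE e e0; exists N => i /bN; apply: le_lt_trans.
  by have /andP[] := ab i.
- move=> a b [a0 aE] [b0 bE]; split=> [i|e e0]; first exact: addr_ge0.
  have e2 : 0 < e / 2 by rewrite divr_gt0.
  have [N aN] := aE _ e2; have [M bM] := bE _ e2.
  exists (maxn N M) => i; rewrite geq_max => /andP[/aN ai /bM bi].
  by rewrite [ltRHS]splitr ltrD.
move=> a Ea.
(* The dominating sequence is the supremum over l of the [a l], each set to 0 inside a radius beyond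
   which it is less than 1 / (l + 1). *)
have hM (l : nat) : exists M : nat, forall i, (M <= `|val i|)%N ->
    a l i < l.+1%:R^-1.
  by apply: (Ea l).2; rewrite invr_gt0.
have [M MP] := choice hM.
pose u (i : idx J) l := if (M l <= `|val i|)%N then a l i else 0.
have u0 i l : 0 <= u i l by rewrite /u; case: ifP => // _; exact: (Ea l).1.
have u1 i l : u i l <= l.+1%:R^-1.
  by rewrite /u; case: ifPn => [/MP/ltW//|_]; rewrite invr_ge0.
have uB i : has_ubound (range (u i)).
  exists 1 => _ [l _ <-]; rewrite (le_trans (u1 i l))//.
  by rewrite invf_le1 ?ler1n// ltr0n.
have uG i l : u i l <= sup (range (u i)) by apply: ub_le_sup => //; exists l.
exists (fun i => sup (range (u i))); last first.
  by move=> l; exists (M l) => i Mi; have := uG i l; rewrite /u Mi.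
split=> [i|e e0]; first exact: le_trans (uG i 0%N).
have e2 : 0 < e / 2 by rewrite divr_gt0.
have [l0 l0e] := ltr_add_invr e2; rewrite add0r in l0e.
have [N NP] := choice (fun l => (Ea l).2 _ e2).
(* From [l0] on the bound 1 / (l + 1) is below e / 2; this sum is a radius that serves all smaller
   l. *)
exists (\sum_(l < l0.+1) N l)%N => i Ni.
apply: (@le_lt_trans _ _ (e / 2)); last by rewrite ltr_pdivrMr// ltr_pMr// ltr1n.
apply: ge_sup; first by exists (u i 0%N), 0%N.
move=> _ [l _ <-]; have [ll|ll] := leqP l0 l.
  rewrite (le_trans (u1 i l))// (le_trans _ (ltW l0e))//.
  by rewrite lef_pV2 ?posrE ?ltr0n// ler_nat.
rewrite /u; case: ifP => _; last exact: ltW.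
apply/ltW/NP; apply: leq_trans Ni.
by rewrite (bigD1 (Ordinal (ltnW ll : (l < l0.+1)%N)))//= leq_addr.
Qed.

Lemma rnorm_c0 (x : c0 X) : rnorm x = c0_norm x.
Proof. exact: of_realK. Qed.

Lemma c0_coord (x : c0 X) k : rnorm (c0_val x k) <= rnorm x.
Proof.
rewrite rnorm_c0; apply: ub_le_sup; last by exists k.
have := valP x; rewrite inE => /(_ 1 ltr01)[N xN].
have [r rP] := index_ball_finite J N.
exists (1 + \sum_(i <- r) rnorm (val x i)) => _ [l _ <-].
have [/xN xl|/rP lr] := leqP N `|val l|%N.
  by rewrite (le_trans (ltW xl))// lerDl sumr_ge0// => i _; exact: rnorm_ge0.
rewrite (big_rem l)//= addrCA lerDl addr_ge0// sumr_ge0// => i _.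
exact: rnorm_ge0.
Qed.

Lemma c0_sequence_space : sequence_space c0_majorant (@c0_val R s J X).
Proof.
split.
- by [].
- move=> y; split=> [i|e e0]; first exact: rnorm_ge0.
  by have := valP y; rewrite inE => /(_ e e0).
- move=> x [_ xE]; have xc : x \in c0_pred by rewrite inE.
  by exists (C0 xc).
- exact: c0_coord.
move=> H e [H0 HE] e0; have e2 : 0 < e / 2 by rewrite divr_gt0.
have [L HL] := HE _ e2; exists L; exists (e / 2) => // y small large.
apply: (@le_lt_trans _ _ (e / 2)); last by rewrite ltr_pdivrMr// ltr_pMr// ltr1n.
rewrite rnorm_c0; apply: ge_sup => [|_ [k _ <-]].
  by have k : idx J by [exists 1; case: (J)]; exists (rnorm (c0_val y k)), k.
have [kL|kL] := leqP L `|val k|%N; last exact: small.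
by rewrite (le_trans (large k kL))// ltW// HL.
Qed.

End c0_sequences.

(** * The spaces l^p *)

Section lp_sequences.
Context {R : realType} {s : scalars} {J : index_set}.
Context {X : idx J -> completeNormedModType (scalar_field R s)}.
Variables (p : R) (p1 : 1 <= p).

Let p0 : 0 < p. Proof. exact: lt_le_trans p1. Qed.

Let powRK (c : R) : 0 <= c -> (c `^ p) `^ p^-1 = c.
Proof. by move=> c0; rewrite -powRrM mulfV ?gt_eqF// powRr1. Qed.

Let powRVK (c : R) : 0 <= c -> (c `^ p^-1) `^ p = c.
Proof. by move=> c0; rewrite -powRrM mulVf ?gt_eqF// powRr1. Qed.

Definition lp_majorant (a : idx J -> R) : Prop :=
  (forall i, 0 <= a i) /\ (pow_sum p a < +oo)%E.

Definition tail_sequence (L : nat) (a : idx J -> R) (i : idx J) : R :=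
  if (L <= `|val i|)%N then a i else 0.

(** Some finite set of indices carries the sum up to [e]; [L] exceeds the absolute values of its
    members. *)
Lemma pow_sum_tail (a : idx J -> R) (e : R) : (pow_sum p a < +oo)%E -> 0 < e ->
  exists L, (pow_sum p (tail_sequence L a) <= e%:E)%E.
Proof.
move=> afin e0.
have aE : pow_sum p a \is a fin_num by rewrite ge0_fin_numE// pow_sum_ge0.
have : (pow_sum p a - e%:E < pow_sum p a)%E by rewrite lteBlDr// lteDl.
move=> /ereal_sup_gt[_ [A [finA _] <-] Ae].
have [r rA] : exists r : seq (idx J), A = [set` r] by exact/finite_seqP.
exists (\max_(i <- r) `|val i|%N).+1.
rewrite -(leeD2lE (x := pow_sum p a - e%:E)) ?fin_numD ?fin_numN ?aE//.
rewrite subeK// {3}/pow_sum (esumID A); last first.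
  by move=> i _; rewrite lee_fin powR_ge0.
rewrite !setTI esum_fset//; last by move=> i _; rewrite lee_fin powR_ge0.
apply: leeD; first exact: ltW.
rewrite [leRHS]esum_mkcond; apply: le_esum => i _.
rewrite /tail_sequence; case: ifPn => [Li|_].
  rewrite mem_set//= rA /= => ir; move: Li; rewrite ltnNge.
  by rewrite (@leq_bigmax_seq _ r xpredT (fun i : idx J => `|val i|%N)).
by rewrite powR0 ?gt_eqF//; case: ifP => // _; rewrite lee_fin powR_ge0.
Qed.

Lemma esum_exchange (I1 I2 : choiceType) (u : I1 -> I2 -> \bar R) :
  (forall i j, 0 <= u i j)%E ->
  \esum_(i in [set: I1]) \esum_(j in [set: I2]) u i j =
  \esum_(j in [set: I2]) \esum_(i in [set: I1]) u i j.
Proof.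
move=> u0; rewrite !esum_esum//.
rewrite (@reindex_esum _ _ _ ([set: I2] `*`` (fun=> [set: I1])) _
  (fun k => (k.2, k.1)))//.
split=> //; first by move=> [? ?] [? ?] _ _ [-> ->].
by move=> [i j] _; exists (j, i).
Qed.

Lemma lp_majorant_class : majorant_class lp_majorant.
Proof.
split.
- by move=> a [].
- split=> //; rewrite /pow_sum esum1 ?ltry// => i _.
  by rewrite powR0// gt_eqF.
- move=> a b [b0 bE] ab; split=> [i|]; first by have /andP[] := ab i.
  by apply: le_lt_trans bE; apply: le_pow_sum => //; exact: ltW.
- move=> a b [a0 aE] [b0 bE]; split=> [i|]; first exact: addr_ge0.
  have root (I : choiceType) (c : I -> R) : (pow_sum p c < +oo)%E ->
      (pow_sum p c <= ((fine (pow_sum p c) `^ p^-1) `^ p)%:E)%E.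
    move=> cE; rewrite powRVK ?fine_ge0 ?pow_sum_ge0//.
    by rewrite fineK// ge0_fin_numE// pow_sum_ge0.
  have := minkowski_pow_sum p1 (powR_ge0 _ _) (powR_ge0 _ _) a0 b0
    (root _ _ aE) (root _ _ bE).
  by move=> /le_lt_trans; apply; exact: ltry.
move=> a Ea.
(* The p-th power of the dominating sequence is the sum over l of the p-th powers of these tails;
   exchanging the sums bounds its total by 1. *)
have hM (l : nat) : exists M,
    (pow_sum p (tail_sequence M (a l)) <= (1 / (2 ^ l.+1)%:R)%:E)%E.
  by apply: pow_sum_tail (Ea l).2 _; rewrite divr_gt0// ltr0n expn_gt0.
have [M MP] := choice hM.
pose u (i : idx J) l : \bar R := (tail_sequence (M l) (a l) i `^ p)%:E.
have u0 i l : (0 <= u i l)%E by rewrite lee_fin powR_ge0.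
have U1 : (\esum_(i in [set: idx J]) \esum_(l in [set: nat]) u i l <= 1)%E.
  rewrite esum_exchange//.
  apply: le_trans (epsilon_trick0 xpredT (@ler01 R)).
  rewrite nneseries_esumT; last by move=> l; rewrite lee_fin divr_ge0.
  by apply: le_esum => l _; exact: MP.
have V0 i : (0 <= \esum_(l in [set: nat]) u i l)%E by exact: esum_ge0.
have V1 i : (\esum_(l in [set: nat]) u i l < +oo)%E.
  apply: le_lt_trans (ltry 1); apply: le_trans U1; apply: esum_ge.
  by exists [set i]; [split|rewrite fsbig_set1].
have uV i l : (u i l <= \esum_(l in [set: nat]) u i l)%E.
  by apply: esum_ge; exists [set l]; [split|rewrite fsbig_set1].
pose V i : R := fine (\esum_(l in [set: nat]) u i l).
have VE i : (V i)%:E = \esum_(l in [set: nat]) u i l.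
  by rewrite fineK// ge0_fin_numE.
exists (fun i => V i `^ p^-1); last first.
  move=> l; exists (M l) => i Mi; have := uV i l.
  rewrite -VE /u /tail_sequence Mi lee_fin => ap.
  rewrite -[leLHS]powRK ?(Ea l).1//.
  by rewrite ge0_ler_powR ?nnegrE ?powR_ge0 ?invr_ge0 ?(ltW p0)// -lee_fin VE.
split=> [i|]; first exact: powR_ge0.
apply: le_lt_trans (ltry 1); apply: le_trans U1; apply: le_esum => i _.
by rewrite powRVK ?VE// -lee_fin VE.
Qed.

Lemma rnorm_lp (x : lp X p1) : rnorm x = lp_norm x.
Proof. exact: of_realK. Qed.

Lemma rnorm_lp_le (x : lp X p1) (c : R) : 0 <= c ->
  (pow_sum p (fun k => rnorm (lp_val x k)) <= (c `^ p)%:E)%E -> rnorm x <= c.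
Proof.
move=> c0 xc; rewrite rnorm_lp /lp_norm -[leRHS]powRK//.
have fin : pow_sum p (fun k => rnorm (lp_val x k)) \is a fin_num.
  by rewrite ge0_fin_numE ?pow_sum_ge0//; apply: le_lt_trans xc (ltry _).
rewrite ge0_ler_powR ?nnegrE ?powR_ge0 ?invr_ge0 ?(ltW p0) ?fine_ge0 ?pow_sum_ge0//.
by rewrite -lee_fin fineK.
Qed.

Lemma lp_coord (x : lp X p1) k : rnorm (lp_val x k) <= rnorm x.
Proof.
rewrite rnorm_lp /lp_norm -[leLHS]powRK ?rnorm_ge0//.
have := valP x; rewrite inE => xE.
rewrite ge0_ler_powR ?nnegrE ?powR_ge0 ?invr_ge0 ?(ltW p0) ?fine_ge0 ?pow_sum_ge0//.
rewrite -lee_fin fineK ?ge0_fin_numE ?pow_sum_ge0//.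
exact: (pow_sum_ub p (fun k => rnorm (lp_val x k))).
Qed.

(** A common majorant of these over a finite ball of indices is an l^p sequence that is at least 1
    on the ball. *)
Lemma lp_majorant_delta k : lp_majorant (fun i => (i == k)%:R).
Proof.
split=> [i|]; first exact: ler0n.
apply: (@le_lt_trans _ _ (\esum_(i in [set k]) 1)%E); last first.
  by rewrite esum_set1// ltry.
rewrite [leRHS]esum_mkcond; apply: le_esum => i _; rewrite in_set1.
by case: eqP => _; rewrite ?powR1 ?powR0 ?gt_eqF.
Qed.

Lemma lp_sequence_space : sequence_space lp_majorant (@lp_val R s J X p p1).
Proof.
split.
- by [].
- move=> y; split=> [i|]; first exact: rnorm_ge0.
  by have := valP y; rewrite inE.
- move=> x [_ xE]; have xc : x \in lp_pred p by rewrite inE.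
  by exists (Lp p1 xc).
- exact: lp_coord.
move=> H e [H0 HE] e0; have e4 : 0 < e / 4 by rewrite divr_gt0.
have [L HL] := pow_sum_tail HE (powR_gt0 p e4).
have [r rP] := index_ball_finite J L.
have [b [b0 bE] rb] := @finite_majorant _ _ _ _ r _ lp_majorant_class lp_majorant_delta.
pose N := fine (pow_sum p b) `^ p^-1.
have bN : pow_sum p b = (N `^ p)%:E.
  rewrite /N powRVK ?fine_ge0 ?pow_sum_ge0//.
  by rewrite fineK// ge0_fin_numE// pow_sum_ge0.
have N0 : 0 <= N by exact: powR_ge0.
(* As [N] is the norm of [b], the sequence d b has norm at most e / 4; it bounds the near
   coordinates of [y], and the tail of [H] the others. The added 1 covers N = 0. *)
pose d := e / 4 / (N + 1).
have d0 : 0 < d by rewrite divr_gt0// ltr_wpDl.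
exists L; exists d => // y small large.
apply: (@le_lt_trans _ _ (e / 4 + e / 4)); last by lra.
apply: rnorm_lp_le; first by rewrite addr_ge0// ltW.
apply: le_trans (minkowski_pow_sum (a := fun i => d * b i)
  (b := tail_sequence L H) p1 (ltW e4) (ltW e4) _ _ _ HL).
- apply: le_pow_sum; first exact: ltW.
  move=> i; rewrite rnorm_ge0 /= /tail_sequence; case: ifPn => [Li|].
    by rewrite (le_trans (large i Li))// lerDr mulr_ge0// ltW.
  rewrite -ltnNge addr0 => iL; rewrite (le_trans (small i iL))// ler_pMr//.
  by have := rb i (rP i iL) i; rewrite eqxx.
- by move=> i; rewrite mulr_ge0// ltW.
- by move=> i; rewrite /tail_sequence; case: ifP.
rewrite pow_sumZ ?(ltW d0)// bN -EFinM -powRM ?(ltW d0)// lee_fin.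
apply: ge0_ler_powR; rewrite ?nnegrE ?(ltW p0) ?(ltW e4)//.
  by rewrite mulr_ge0// ltW.
rewrite /d -mulrA ler_piMr ?(ltW e4)// mulrC ler_pdivrMr ?mul1r ?lerDl//.
by rewrite ltr_wpDl.
Qed.

End lp_sequences.

Theorem proposition3p12 (R : realType) (s : scalars) (J : index_set)
    (X : idx J -> completeNormedModType (scalar_field R s))
    (T : forall k : idx J, {linear X (idx_next k) -> X k})
    (bT : uniformly_bounded T) :
  (forall (p : R) (p1 : 1 <= p),
    chaotic (lp_shift bT p1) -> frequently_hypercyclic (lp_shift bT p1)) /\
  (chaotic (c0_shift bT) -> frequently_hypercyclic (c0_shift bT)).
Proof.
split=> [p p1|].
- exact: (chaotic_frequently_hypercyclic (T := T) (lp_majorant_class p1)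
    (lp_sequence_space p1)).
- exact: (chaotic_frequently_hypercyclic (T := T) c0_majorant_class
    c0_sequence_space).
Qed.
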